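(* Let $X$ be a compact Hausdorff space, and let $\mathcal H_\alpha$, $\{k_x^\alpha\}_{x\in X}$, $\nu_\alpha$ be as described in the context, with each $\mathcal H_\alpha$ finite-dimensional. Assume that $d\nu_\alpha=c(\alpha)\,d\nu$ with $c(\alpha)=\dim\mathcal H_\alpha$ and $\nu$ a finite Radon measure on $X$ independent of $\alpha$, and that for every $x\in X$ and every neighborhood $U$ of $x$, $\int_{X\setminus U}|\langle k_x^\alpha,k_y^\alpha\rangle_\alpha|^2\,d\nu_\alpha(y)\to0$ as $\alpha\to\infty$. Let $\sigma\in L^1(X,\nu)$ be real-valued and either bounded or non-negative, and let $\lambda_1^\alpha\ge\lambda_2^\alpha\ge\cdots\ge\lambda_{\dim\mathcal H_\alpha}^\alpha$ be the eigenvalues of $T_\sigma^\alpha$ counted with multiplicity. Then for any $t\in\mathbb R$ such that $\nu(\{\sigma=t\})=0$, $$\lim_{\alpha\to\infty}\frac1{\dim\mathcal H_\alpha}\#\{j:\lambda_j^\alpha>t\}=\nu(\{x\in X:\sigma(x)>t\}).$$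
   Context: For each value of a parameter $\alpha$ (limits are taken as $\alpha\to\infty$), $\mathcal H_\alpha$ is a Hilbert space with inner product $\langle\cdot,\cdot\rangle_\alpha$, and $\{k_x^\alpha:x\in X\}\subset\mathcal H_\alpha$ is a normalized continuous Parseval frame with frame Radon measure $\nu_\alpha$ on $X$: $\|k_x^\alpha\|_\alpha=1$ for all $x$, the functions $x\mapsto\langle f,k_x^\alpha\rangle_\alpha$ are Borel measurable, and $f=\int_X\langle f,k_x^\alpha\rangle_\alpha k_x^\alpha\,d\nu_\alpha(x)$ weakly for every $f\in\mathcal H_\alpha$. The Toeplitz operator is $T_\sigma^\alpha f=\int_X\sigma(x)\langle f,k_x^\alpha\rangle_\alpha k_x^\alpha\,d\nu_\alpha(x)$ (weakly defined); it is self-adjoint for real-valued $\sigma$. *)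

(* Defs.v *)
From HB Require Import structures.
From mathcomp Require Import all_boot all_order all_algebra.
From mathcomp Require Import sesquilinear.
From mathcomp Require Import all_classical all_reals all_analysis.
From mathcomp Require Import complex.

Set Implicit Arguments.
Unset Strict Implicit.
Unset Printing Implicit Defensive.

Import Order.TTheory GRing.Theory Num.Def Num.Theory.
Import numFieldNormedType.Exports.

Local Open Scope classical_set_scope.
Local Open Scope ring_scope.
Local Open Scope complex_scope.

Notation Borel X := (g_sigma_algebraType (@open X)).

Definition radon (R : realType) (X : ptopologicalType)
    (mu : {measure set (Borel X) -> \bar R}) : Prop :=
  (forall K : set X, compact K -> (mu K < +oo)%E) /\
  (forall B : set (Borel X), measurable B ->
    mu B = ereal_sup [set mu K | K in [set K : set X | compact K /\ K `<=` B]]).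

Section complex_valued.
Context d (T : measurableType d) (R : realType).
Implicit Types (mu : {measure set T -> \bar R}) (f : T -> R[i]).

Definition Cmeasurable f : Prop :=
  measurable_fun setT (fun x => complex.Re (f x)) /\
  measurable_fun setT (fun x => complex.Im (f x)).

Definition Cintegrable mu f : Prop :=
  mu.-integrable setT (fun x => (complex.Re (f x))%:E) /\
  mu.-integrable setT (fun x => (complex.Im (f x))%:E).

Definition Cintegral mu f : R[i] :=
  (\int[mu]_x complex.Re (f x)) +i* (\int[mu]_x complex.Im (f x)).

End complex_valued.

(* Finite-dimensional complex Hilbert spaces are represented by a [vectType]
   over [R[i]] with a positive definite Hermitian form [ip], which is linear
   in its first argument and conjugate-linear in its second one.  Completeness
   is automatic in finite dimension. *)
Section hilbert.
Context (R : realType) (H : vectType R[i]) (ip : {dot H for conjC}).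

Definition hnorm (u : H) : R[i] := sqrtC (ip u u).

Section weak_integrals.
Context d (T : measurableType d) (mu : {measure set T -> \bar R}).

Definition is_weak_integral (F : T -> H) (h : H) : Prop :=
  forall g : H, Cintegrable mu (fun x => ip (F x) g) /\
                ip h g = Cintegral mu (fun x => ip (F x) g).

(* The junk value 0 is taken when no weak integral exists; when one exists, it
   is unique because [ip] is definite. *)
Definition weak_integral (F : T -> H) : H := xget 0 (is_weak_integral F).

(* [linfun] only bundles the map as an element of ['End(H)]. *)
Definition toeplitz (k : T -> H) (sigma : T -> R) : 'End(H) :=
  linfun (fun f => weak_integral (fun x => ((sigma x)%:C * ip f (k x)) *: k x)).

End weak_integrals.

Record parseval_frame (X : ptopologicalType)
    (mu : {measure set (Borel X) -> \bar R}) (k : X -> H) : Prop := {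
  frame_radon : radon mu ;
  frame_normalized : forall x, hnorm (k x) = 1 ;
  frame_measurable : forall f, @Cmeasurable _ (Borel X) R (fun x => ip f (k x)) ;
  frame_reproducing :
    forall f, is_weak_integral mu (fun x => ip f (k x) *: k x) f }.

End hilbert.

Definition eigenvalue_list (R : realType) (H : vectType R[i]) (T : 'End(H))
    (l : (\dim {:H}).-tuple R) : Prop :=
  sorted (fun a b => b <= a) l /\
  forall z : R[i], count_mem z [seq r%:C | r <- l] = \dim (passmx.leigenspace T z).

(* Main.v *)
Require Import Defs.
From HB Require Import structures.
From mathcomp Require Import all_boot all_order all_algebra.
From mathcomp Require Import sesquilinear.
From mathcomp Require Import all_classical all_reals all_analysis.
From mathcomp Require Import complex.
From mathcomp Require Import ring lra measurable_realfun.

(** Let [d] be the dimension, [K(x, y) = d |<k_x, k_y>|^2], a symmetric Markov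
    density for [nu], and let [u_j] be an orthonormal eigenbasis of the Toeplitz
    operator, [p_j(x) = |<u_j, k_x>|^2].  Then [sum_j p_j = 1],
    [d int p_j dnu = 1], [d int sigma p_j dnu = lambda_j] and
    [sum_j lambda_j p_j(x) = int sigma(y) K(x, y) dnu(y)].  Jensen's inequality
    for the convex functions [r |-> (r - s)^+], applied in both directions
    (Berezin-Lieb), gives
      [int (sigma - s)^+ dnu - D <= d^-1 sum_j (lambda_j - s)^+
                                 <= int (sigma - s)^+ dnu]
    with [D = int int |sigma(y) - sigma(x)| K(x, y) dnu dnu].  The difference
    quotients of [r |-> (r - s)^+] squeeze the indicator of [(t, +oo)], so the
    eigenvalue count is controlled by [nu {sigma > t + h}] and
    [nu {sigma > t - h}] up to [D / h].

    That [D] tends to [0] holds for indicators of open sets [U], where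
    [D = 2 int_U int_{~U} K], by localization and dominated convergence; it
    passes to Borel sets by regularity and to all of [L^1] because both
    marginals of [K dnu dnu] are [nu]. *)

Set Implicit Arguments.
Unset Strict Implicit.
Unset Printing Implicit Defensive.

Import Order.TTheory GRing.Theory Num.Def Num.Theory.
Import numFieldNormedType.Exports.

Local Open Scope classical_set_scope.
Local Open Scope ring_scope.
Local Open Scope complex_scope.

(** An eventual real upper bound also forces eventual finiteness, so for nonnegative values the
    upper bounds alone decide convergence to zero. *)
Lemma ge0_cvge0P (R : realType) (I : Type) (F : set_system I) {FF : Filter F}
    (u : I -> \bar R) : (forall i, 0 <= u i)%E ->
  u @ F --> 0%E <-> forall e : R, 0 < e -> \forall i \near F, (u i <= e%:E)%E.
Proof.
move=> u0; split=> [/fine_cvgP[ufin /cvgrPdist_le u_0] e e0|u_e].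
  near=> i; have ui : u i \is a fin_num by near: i.
  rewrite -(fineK ui) lee_fin -[fine _]ger0_norm ?fine_ge0// -normrN -sub0r.
  by near: i; exact: u_0.
apply/fine_cvgP; split; first by near=> i; rewrite ge0_fin_numE//;
  apply: le_lt_trans (ltry 1); near: i; exact: u_e.
apply/cvgrPdist_le => e e0; near=> i.
have uie : (u i <= e%:E)%E by near: i; exact: u_e.
rewrite sub0r normrN ger0_norm/= ?fine_ge0// -lee_fin fineK//.
by rewrite ge0_fin_numE// (le_lt_trans uie) ?ltry.
Unshelve. all: by end_near. Qed.

(** * Oscillation along a Markov density *)

Section oscillation.
Context d (T : measurableType d) (R : realType).
Context (nu : {finite_measure set T -> \bar R}).
Implicit Types (K : T * T -> R) (h g : T -> R).

Record symmetric_markov_density K : Prop := {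
  smd_measurable : measurable_fun setT K ;
  smd_ge0 : forall z, 0 <= K z ;
  smd_sym : forall x y, K (x, y) = K (y, x) ;
  smd_mass : forall x, (\int[nu]_y (K (x, y))%:E = 1)%E }.

(** This is the mean of [|h y - h x|] over pairs with joint density [K]. It lives in the extended
    reals, so that it makes sense for every [h], integrable or not. *)
Definition oscillation K h : \bar R :=
  (\int[(nu \x nu)%E]_z (`|h z.2 - h z.1| * K z)%:E)%E.

Section density.
Context K (HK : symmetric_markov_density K).

Lemma measurable_osc h : measurable_fun setT h ->
  measurable_fun setT (fun z : T * T => (`|h z.2 - h z.1| * K z)%:E).
Proof.
move=> mh; apply/measurable_EFinP; apply: measurable_funM; last exact: smd_measurable.
apply: measurableT_comp => //; apply: measurable_funB.
  exact: measurableT_comp.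
exact: measurableT_comp.
Qed.

Lemma measurable_density_slice x : measurable_fun setT (fun y => K (x, y)).
Proof. by apply: measurableT_comp; [exact: smd_measurable|exact: measurable_pair1]. Qed.

Lemma integral_density_fst h : measurable_fun setT h -> (forall x, 0 <= h x) ->
  (\int[(nu \x nu)%E]_z (h z.1 * K z)%:E = \int[nu]_x (h x)%:E)%E.
Proof.
move=> mh h0; rewrite fubini_tonelli1/=.
- apply: eq_integral => x _; rewrite /fubini_F/=.
  under eq_integral do rewrite EFinM.
  rewrite ge0_integralZl_EFin ?(smd_mass HK) ?mule1//.
  + by move=> y _; rewrite lee_fin (smd_ge0 HK).
  + by apply/measurable_EFinP; exact: measurable_density_slice.
- apply/measurable_EFinP; apply: measurable_funM; last exact: smd_measurable.
  exact: measurableT_comp.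
- by move=> z; rewrite lee_fin mulr_ge0// (smd_ge0 HK).
Qed.

(** Integrating the first variable out first and using the symmetry of [K] reduces to the mass
    condition, so the second marginal is [nu] as well. *)
Lemma integral_density_snd h : measurable_fun setT h -> (forall x, 0 <= h x) ->
  (\int[(nu \x nu)%E]_z (h z.2 * K z)%:E = \int[nu]_x (h x)%:E)%E.
Proof.
move=> mh h0.
have mhK : measurable_fun setT (fun z : T * T => h z.2 * K z).
  apply: measurable_funM; last exact: smd_measurable.
  exact: measurableT_comp.
rewrite fubini_tonelli1 ?fubini_tonelli/=.
- apply: eq_integral => x _; rewrite /fubini_G/=.
  under eq_integral do rewrite EFinM (smd_sym HK).
  rewrite ge0_integralZl_EFin ?(smd_mass HK) ?mule1//.
  + by move=> y _; rewrite lee_fin (smd_ge0 HK).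
  + by apply/measurable_EFinP; exact: measurable_density_slice.
- exact/measurable_EFinP.
- by move=> z; rewrite lee_fin mulr_ge0// (smd_ge0 HK).
- exact/measurable_EFinP.
- by move=> z; rewrite lee_fin mulr_ge0// (smd_ge0 HK).
Qed.

Lemma oscillation_ge0 h : (0 <= oscillation K h)%E.
Proof.
by apply: integral_ge0 => z _; rewrite lee_fin mulr_ge0// (smd_ge0 HK).
Qed.

Lemma oscillationD h g : measurable_fun setT h -> measurable_fun setT g ->
  (oscillation K (fun x => h x + g x)%R <= oscillation K h + oscillation K g)%E.
Proof.
move=> mh mg; rewrite /oscillation -ge0_integralD//=.
- apply: ge0_le_integral => //=.
  + by move=> z _; rewrite lee_fin mulr_ge0// (smd_ge0 HK).
  + exact: (measurable_osc (measurable_funD mh mg)).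
  + by apply: emeasurable_funD; exact: measurable_osc.
  + move=> z _; rewrite -EFinD lee_fin -mulrDl ler_wpM2r ?(smd_ge0 HK)//.
    by rewrite opprD addrACA ler_normD.
- by move=> z _; rewrite lee_fin mulr_ge0// (smd_ge0 HK).
- exact: measurable_osc.
- by move=> z _; rewrite lee_fin mulr_ge0// (smd_ge0 HK).
- exact: measurable_osc.
Qed.

Lemma oscillationZ c h : measurable_fun setT h ->
  (oscillation K (fun x => c * h x)%R = `|c|%:E * oscillation K h)%E.
Proof.
move=> mh; rewrite /oscillation -ge0_integralZl_EFin//=.
- by apply: eq_integral => z _; rewrite -EFinM mulrA -normrM mulrBr.
- by move=> z _; rewrite lee_fin mulr_ge0// (smd_ge0 HK).
- exact: measurable_osc.
Qed.

(** The triangle inequality bounds [|h y - h x|] by [|h y| + |h x|]; each term integrates to the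
    norm of [h] because both marginals are [nu], hence the factor 2. *)
Lemma oscillation_le_L1 h : measurable_fun setT h ->
  (oscillation K h <= 2%:E * \int[nu]_x `|h x|%:E)%E.
Proof.
move=> mh.
have mn : measurable_fun setT (fun x => `|h x|) by exact: measurableT_comp.
have mnK1 : measurable_fun setT (fun z : T * T => `|h z.1| * K z).
  apply: measurable_funM; last exact: smd_measurable.
  by apply: measurableT_comp => //; exact: measurableT_comp.
have mnK2 : measurable_fun setT (fun z : T * T => `|h z.2| * K z).
  apply: measurable_funM; last exact: smd_measurable.
  by apply: measurableT_comp => //; exact: measurableT_comp.
rewrite (_ : 2%:E = 1 + 1)%E ?ge0_muleDl ?mul1e// -?EFinD//.
rewrite -{1}(integral_density_snd mn)// -(integral_density_fst mn)//.
rewrite -ge0_integralD//=.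
- apply: ge0_le_integral => //=.
  + by move=> z _; rewrite lee_fin mulr_ge0// (smd_ge0 HK).
  + exact: measurable_osc.
  + by apply: emeasurable_funD; apply/measurable_EFinP.
  + move=> z _; rewrite -EFinD lee_fin -mulrDl ler_wpM2r ?(smd_ge0 HK)//.
    exact: ler_normB.
- by move=> z _; rewrite lee_fin mulr_ge0// (smd_ge0 HK).
- exact/measurable_EFinP.
- by move=> z _; rewrite lee_fin mulr_ge0// (smd_ge0 HK).
- exact/measurable_EFinP.
Qed.

(** The error does not depend on [K]. This uniformity is what lets a limit along a sequence of
    densities pass from a dense class to all of L^1. *)
Lemma oscillation_perturb h g : measurable_fun setT h -> measurable_fun setT g ->
  (oscillation K h <= oscillation K g + 2%:E * \int[nu]_x `|h x - g x|%:E)%E.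
Proof.
move=> mh mg; have mhg := measurable_funB mh mg.
apply: le_trans (leeD2l _ (oscillation_le_L1 mhg)) => /=.
rewrite {1}(_ : h = fun x => g x + (h \- g) x); first exact: oscillationD.
by apply/funext => x /=; rewrite addrC subrK.
Qed.

(** The difference of indicators has modulus 1 exactly when one point of the pair lies in [U] and
    the other outside; by symmetry of [K] the two cases contribute equally. *)
Lemma oscillation_indic U : measurable U ->
  (oscillation K \1_U =
   2%:E * \int[nu]_(x in U) \int[nu]_(y in ~` U) (K (x, y))%:E)%E.
Proof.
move=> mU.
have mUC : measurable (~` U) by exact: measurableC.
(* [f1] and [f2] split the integrand according to which coordinate lies in [U]. *)
pose f1 (z : T * T) : R := \1_U z.1 * (\1_(~` U) z.2 * K z).
pose f2 (z : T * T) : R := \1_U z.2 * (\1_(~` U) z.1 * K z).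
have f10 z : 0 <= f1 z by rewrite /f1 !mulr_ge0// (smd_ge0 HK).
have f20 z : 0 <= f2 z by rewrite /f2 !mulr_ge0// (smd_ge0 HK).
have mf1 : measurable_fun setT f1.
  apply: measurable_funM; first by apply: measurableT_comp.
  apply: measurable_funM; first by apply: measurableT_comp.
  exact: smd_measurable.
have mf2 : measurable_fun setT f2.
  apply: measurable_funM; first by apply: measurableT_comp.
  apply: measurable_funM; first by apply: measurableT_comp.
  exact: smd_measurable.
have inner x : (\int[nu]_y (\1_(~` U) y * K (x, y))%:E =
                \int[nu]_(y in ~` U) (K (x, y))%:E)%E.
  rewrite [RHS]integral_mkcond; apply: eq_integral => y _.
  by rewrite patchE indicE; case: ifP => _; rewrite ?mul1r ?mul0r.
have outer : (\int[nu]_x ((\1_U x)%:E * \int[nu]_(y in ~` U) (K (x, y))%:E) =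
    \int[nu]_(x in U) \int[nu]_(y in ~` U) (K (x, y))%:E)%E.
  rewrite [RHS]integral_mkcond; apply: eq_integral => x _.
  by rewrite patchE indicE; case: ifP => _; rewrite ?mul1e ?mul0e.
have mslice x : measurable_fun setT (fun y => (\1_(~` U) y * K (x, y))%:E).
  apply/measurable_EFinP; apply: measurable_funM => //.
  exact: measurable_density_slice.
have I1 : (\int[(nu \x nu)%E]_z (f1 z)%:E =
    \int[nu]_(x in U) \int[nu]_(y in ~` U) (K (x, y))%:E)%E.
  rewrite fubini_tonelli1 -?outer/=; [|exact/measurable_EFinP|by []].
  apply: eq_integral => x _; rewrite /fubini_F /f1/=.
  under eq_integral do rewrite EFinM.
  rewrite ge0_integralZl_EFin ?inner//.
  by move=> y _; rewrite lee_fin mulr_ge0// (smd_ge0 HK).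
have I2 : (\int[(nu \x nu)%E]_z (f2 z)%:E =
    \int[nu]_(x in U) \int[nu]_(y in ~` U) (K (x, y))%:E)%E.
  rewrite fubini_tonelli1 ?fubini_tonelli -?outer/=; do 1?[exact/measurable_EFinP|by []].
  apply: eq_integral => x _; rewrite /fubini_G /f2/=.
  under eq_integral do rewrite EFinM (smd_sym HK).
  rewrite ge0_integralZl_EFin ?inner//.
  by move=> y _; rewrite lee_fin mulr_ge0// (smd_ge0 HK).
rewrite (_ : 2%:E = 1 + 1)%E ?ge0_muleDl ?mul1e// -?EFinD//.
rewrite -{1}I1 -I2 -ge0_integralD//=; [|by move=> z _; rewrite lee_fin
  |exact/measurable_EFinP|by move=> z _; rewrite lee_fin|exact/measurable_EFinP].
apply: eq_integral => z _; rewrite -EFinD; congr EFin.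
rewrite /f1 /f2 !indicE !in_setC.
case: (z.1 \in U); case: (z.2 \in U);
  by rewrite /= ?subrr ?subr0 ?sub0r ?normrN ?normr0 ?normr1 ?mul1r ?mul0r ?mulr0
    ?addr0 ?add0r.
Qed.

Lemma measurable_density_mass B : measurable B ->
  measurable_fun setT (fun x => \int[nu]_(y in B) (K (x, y))%:E)%E.
Proof.
move=> mB.
(* Moving the restriction to [B] into an indicator factor brings the function into the form covered
   by Tonelli. *)
rewrite (_ : (fun x => _) = (fun x => \int[nu]_y (\1_B y * K (x, y))%:E)%E).
  apply: (@measurable_fun_fubini_tonelli_F _ _ _ _ _ nu
           (fun z => (\1_B z.2 * K z)%:E)).
    apply/measurable_EFinP; apply: measurable_funM; last exact: smd_measurable.
    by apply: measurableT_comp.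
  by move=> z; rewrite lee_fin mulr_ge0// (smd_ge0 HK).
apply/funext => x; rewrite integral_mkcond; apply: eq_integral => y _.
by rewrite patchE indicE; case: ifP => _; rewrite ?mul1r ?mul0r.
Qed.

Lemma density_mass_le1 B x : measurable B ->
  (\int[nu]_(y in B) (K (x, y))%:E <= 1)%E.
Proof.
move=> mB; rewrite -(smd_mass HK x); apply: ge0_subset_integral => //.
- by apply/measurable_EFinP; exact: measurable_density_slice.
- by move=> y _; rewrite lee_fin (smd_ge0 HK).
Qed.

Lemma abse_density_mass_le1 B x : measurable B ->
  (`|\int[nu]_(y in B) (K (x, y))%:E| <= 1)%E.
Proof.
move=> mB; rewrite gee0_abs ?density_mass_le1//.
by apply: integral_ge0 => y _; rewrite lee_fin (smd_ge0 HK).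
Qed.

End density.
End oscillation.

(** * Vanishing oscillation for localized densities *)

Section oscillation_limit.
Context (R : realType) (X : ptopologicalType) (X_hausdorff : hausdorff_space X).
Context (nu : {finite_measure set (Borel X) -> \bar R}) (nu_radon : radon nu).
Context (K : nat -> Borel X * Borel X -> R).
Context (HK : forall n, symmetric_markov_density nu (K n)).
Context (K_localized : forall (U : set X) (x : X), open U -> U x ->
  (\int[nu]_(y in ~` U) (K n (x, y))%:E)%E @[n --> \oo] --> 0%E).

Let osc0 h := oscillation nu (K n) h @[n --> \oo] --> 0%E.

(** The functions with vanishing oscillation are closed in L^1, by the uniform perturbation
    bound. *)
Let osc0_approx (h : Borel X -> R) : measurable_fun setT h ->
  (forall e : R, 0 < e -> exists g, [/\ measurable_fun setT g, osc0 g &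
    (\int[nu]_x `|h x - g x|%:E <= e%:E)%E]) -> osc0 h.
Proof.
move=> mh hg.
apply/ge0_cvge0P => [n|e e0]; first exact: oscillation_ge0.
(* The oscillation of [g] costs one quarter of [e] and the L^1 distance enters twice, for a total of
   three quarters. *)
have e40 : 0 < e / 4 by rewrite divr_gt0.
have [g [mg g0 ghe]] := hg _ e40.
move/ge0_cvge0P : g0 => /(_ (fun n => oscillation_ge0 (HK n) g)) /(_ _ e40).
apply: filterS => n gn; apply: le_trans (oscillation_perturb (HK n) mh mg) _.
apply: (@le_trans _ _ ((e / 4)%:E + 2%:E * (e / 4)%:E)%E).
  by rewrite leeD// lee_wpmul2l.
rewrite -EFinM -EFinD lee_fin; lra.
Qed.

(** An open [U] is a neighborhood of each of its points, so the mass that [K n (x, _)] puts outside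
    [U] tends to 0 for every [x] in [U]. These masses are at most 1, which is integrable since [nu]
    is finite, and dominated convergence applies. *)
Let osc0_open (U : set X) : open U -> osc0 \1_U.
Proof.
move=> oU; have mU : measurable (U : set (Borel X)) by exact: sub_sigma_algebra.
have mUC : measurable (~` U : set (Borel X)) by exact: measurableC.
rewrite /osc0; under eq_fun do rewrite oscillation_indic//.
rewrite -(mule0 2%:E); apply: cvgeZl => //.
have i1 : nu.-integrable U (cst 1%E).
  apply/integrableP; split => //.
  rewrite (eq_integral (cst 1%E)); last by move=> x _ /=; rewrite normr1.
  by rewrite integral_cst// mul1e ltey_eq fin_num_measure.
have [_ _] := @dominated_convergence _ (Borel X) R nu U mU
   (fun n x => \int[nu]_(y in ~` U) (K n (x, y))%:E)%E (cst 0%E) (cst 1%E)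
   (fun n => measurable_funTS (measurable_density_mass (HK n) mUC)) (measurable_cst _)
   (aeW _ (fun x Ux => K_localized oU Ux)) i1
   (aeW _ (fun x n Ux => abse_density_mass_le1 (HK n) x mUC)).
by rewrite integral0.
Qed.

Let osc0_indic (E : set (Borel X)) : measurable E -> osc0 \1_E.
Proof.
move=> mE; apply: osc0_approx => [|e e0]; first exact: measurable_indic.
have mEC : measurable (~` E) by exact: measurableC.
have [_ /(_ _ mEC) nuEC] := nu_radon.
have fEC : nu (~` E) \is a fin_num by exact: fin_num_measure.
have : (nu (~` E) - e%:E < nu (~` E))%E by rewrite lteBlDr// lteDl// lte_fin.
rewrite {2}nuEC => /ereal_sup_gt[_ [C [cC CE] <-]] eC.
(* The Hausdorff property makes the compact set closed. *)
have clC : closed C by exact: compact_closed.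
have oC : open (~` C) by exact: closed_openC.
have mC : measurable (C : set (Borel X)).
  by rewrite -(setCK C); apply: measurableC; exact: sub_sigma_algebra.
exists \1_(~` C); split; first by apply: measurable_indic; exact: measurableC.
  exact: osc0_open.
rewrite (eq_integral (fun x => (\1_(~` E `\` C) x)%:E)); last first.
  move=> x _; congr EFin; rewrite !indicE in_setD !in_setC.
  case: (boolP (x \in E)) => xE; case: (boolP (x \in C)) => xC //=;
    rewrite ?subrr ?subr0 ?sub0r ?normrN ?normr0 ?normr1//.
  by exfalso; move: (CE x); rewrite !inE in xE xC => /(_ xC).
rewrite integral_indic//; last exact: measurableD.
rewrite setIT measureD//; last by rewrite ltey_eq fEC.
rewrite setIidr// leeBlDr// ?fin_num_measure//.
by rewrite -leeBlDl// ltW.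
Qed.

Import HBSimple.

(** Simple functions are dense in L^1, and a simple function is a finite combination of indicators,
    to which subadditivity and homogeneity of the oscillation apply. *)
Lemma oscillation_cvg0 h : nu.-integrable setT (EFin \o h) ->
  oscillation nu (K n) h @[n --> \oo] --> 0%E.
Proof.
move=> ih; have mh : measurable_fun setT h by apply/measurable_EFinP; exact: measurable_int ih.
apply: osc0_approx => // e e0.
have [g [_ _ /ge0_cvge0P]] := approximation_sfun_integrable measurableT ih.
have i0 n : (0 <= \int[nu]_z `|(EFin \o h) z - (g n z)%:E|)%E by exact: integral_ge0.
move=> /(_ i0 _ e0) [n _ /(_ n (leqnn n))] ge.
exists (g n); split => //.
have mI y : measurable_fun setT (fun x : Borel X => y * (\1_(g n @^-1` [set y]) x : R)).
  by apply: measurable_funM => //; exact: measurable_indic.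
have -> : g n = (fun x =>
    \sum_(y <- finmap.enum_fset (fset_set (range (g n))))
      (y * \1_(g n @^-1` [set y]) x)) :> (_ -> _).
  by apply/funext => x; rewrite fimfunE fsbig_finite.
(* The induction runs over the list of values with [g n] fixed, so each step adds one level set to a
   partial sum. *)
elim: (finmap.enum_fset _) => [|y s IHs].
  rewrite /osc0/oscillation.
  under eq_fun do (under eq_integral do rewrite !big_nil subrr normr0 mul0r).
  under eq_fun do rewrite integral0.
  exact: cvg_cst.
have ms : measurable_fun setT (fun x : Borel X =>
    \sum_(y <- s) (y * (\1_(g n @^-1` [set y]) x : R))).
  exact: measurable_sum.
have y0 : (`|y|%:E * oscillation nu (K k) \1_(g n @^-1` [set y]))%E @[k --> \oo] --> 0%E.
  rewrite -(mule0 `|y|%:E); apply: cvgeZl => //; exact: osc0_indic.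
apply: (@squeeze_cvge _ _ _ _ (cst 0%E) _
  (fun k => `|y|%:E * oscillation nu (K k) \1_(g n @^-1` [set y]) +
   oscillation nu (K k) (fun x => \sum_(y <- s) (y * \1_(g n @^-1` [set y]) x))%R)%E).
- near=> k; rewrite oscillation_ge0//= -oscillationZ// .
  rewrite (_ : (fun x => _) = (fun x => y * \1_(g n @^-1` [set y]) x +
     \sum_(y <- s) (y * \1_(g n @^-1` [set y]) x))); last first.
    by apply/funext => x; rewrite big_cons.
  exact: oscillationD.
- exact: cvg_cst.
- by rewrite -(adde0 0%E); apply: cvgeD.
Unshelve. all: by end_near. Qed.

End oscillation_limit.

(** * Berezin-Lieb inequalities and eigenvalue counting *)

Section positive_part.
Context (R : realType).
Implicit Types s t h r : R.

Definition pospart s r : R := Num.max (r - s) 0.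

Lemma pospart_ge0 s r : 0 <= pospart s r.
Proof. by rewrite /pospart le_max lexx orbT. Qed.

Lemma pospart_ge s r : r - s <= pospart s r.
Proof. by rewrite /pospart le_max lexx. Qed.

Lemma pospart_le s r a : r - s <= a -> 0 <= a -> pospart s r <= a.
Proof. by move=> ra a0; rewrite /pospart ge_max ra. Qed.

(** Together with the next lemma, this places the difference quotient of [pospart] over [[s, s + h]]
    between the indicators of [s + h < r] and of [s < r]. *)
Lemma pospart_step_le h s r : 0 < h ->
  h * (s + h < r)%R%:R + pospart (s + h) r <= pospart s r.
Proof.
move=> h0; have := pospart_ge s r; have := pospart_ge0 s r.
case: (ltP (s + h) r) => /= rs p0 p1; rewrite ?mulr1 ?mulr0 ?add0r -?lerBrDl;
  apply: pospart_le; lra.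
Qed.

Lemma pospart_step_ge h s r : 0 < h ->
  pospart s r <= pospart (s + h) r + h * (s < r)%R%:R.
Proof.
move=> h0; have := pospart_ge (s + h) r; have := pospart_ge0 (s + h) r.
by case: (ltP s r) => /= rs p0 p1; rewrite ?mulr1 ?mulr0 ?addr0;
  apply: pospart_le; lra.
Qed.

Lemma pospart_lipschitz s r a : pospart s r <= pospart s a + `|r - a|.
Proof.
apply: pospart_le; last by rewrite addr_ge0 ?pospart_ge0.
by have := pospart_ge s a; have := ler_norm (r - a); lra.
Qed.

(** Jensen for a finite average: [pospart s] is the maximum of two affine functions, and each of
    them commutes with averaging. *)
Lemma pospart_sum N (w a : 'I_N -> R) s :
  (forall j, 0 <= w j) -> \sum_j w j = 1 ->
  pospart s (\sum_j a j * w j) <= \sum_j pospart s (a j) * w j.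
Proof.
move=> w0 w1; apply: pospart_le.
  rewrite -[X in _ - X]mulr1 -w1 mulr_sumr -sumrB; apply: ler_sum => j _.
  by rewrite -mulrBl ler_wpM2r ?pospart_ge.
by apply: sumr_ge0 => j _; rewrite mulr_ge0 ?pospart_ge0.
Qed.

End positive_part.

Lemma measurable_superlevel d (T : measurableType d) (R : realType)
    (f : T -> R) (s : R) :
  measurable_fun setT f -> measurable [set x | s < f x].
Proof.
move=> mf; rewrite (_ : [set x | _] = setT `&` f @^-1` `]s, +oo[%classic).
  exact: mf.
by apply/seteqP; split => x /=; rewrite in_itv /= andbT => // -[].
Qed.

(** * Comparison of the symbol with the eigenvalues *)

Section spectral_counting.
Context d (T : measurableType d) (R : realType).
Context (nu : {finite_measure set T -> \bar R}).
Context (sigma : T -> R) (sigma_L1 : nu.-integrable setT (EFin \o sigma)).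

Let sigma_measurable : measurable_fun setT sigma.
Proof. by apply/measurable_EFinP; exact: measurable_int sigma_L1. Qed.

Let measurable_pospart s : measurable_fun setT (fun x => pospart s (sigma x)).
Proof. by apply: measurable_maxr => //; exact: measurable_funB. Qed.

Let measurable_superlevel_sigma s : measurable [set x | s < sigma x].
Proof. exact: measurable_superlevel. Qed.

Definition excess s : \bar R := (\int[nu]_x (pospart s (sigma x))%:E)%E.

Lemma integrable_pospart s : nu.-integrable setT (fun x => (pospart s (sigma x))%:E).
Proof.
have ic : nu.-integrable setT (fun x => (sigma x)%:E + (- s)%:E)%E.
  by apply: integrableD => //; exact: finite_measure_integrable_cst.
apply: le_integrable ic => //; first exact/measurable_EFinP.
move=> x _; rewrite -EFinD /= lee_fin ger0_norm ?pospart_ge0//.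
by apply: pospart_le; rewrite ?ler_norm.
Qed.

(** Finiteness allows the counting estimates to be carried out as linear arithmetic in the reals. *)
Lemma excess_fin_num s : excess s \is a fin_num.
Proof. exact: integrable_fin_num (integrable_pospart s). Qed.

Let integral_superlevel (h s : R) : 0 < h ->
  (\int[nu]_x (h * (s < sigma x)%R%:R)%:E = h%:E * nu [set x | (s < sigma x)%R])%E.
Proof.
move=> h0; have ms := measurable_superlevel_sigma s.
rewrite -[in RHS](setIT [set x | _]) -integral_indic//.
rewrite -ge0_integralZl_EFin ?ltW//; last exact/measurable_EFinP.
by apply: eq_integral => x _; rewrite -EFinM indicE mem_setE.
Qed.

Let measurable_superlevel_fun (h s : R) :
  measurable_fun setT (fun x => (h * (s < sigma x)%R%:R : R)%:E).
Proof.
apply/measurable_EFinP; apply: measurable_funM => //.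
rewrite (_ : (fun x => _) = \1_[set x | s < sigma x]).
  exact/measurable_indic/measurable_superlevel_sigma.
by apply/funext => x; rewrite indicE mem_setE.
Qed.

Lemma excess_step_le (h s : R) : 0 < h ->
  (h%:E * nu [set x | (s + h < sigma x)%R] + excess (s + h) <= excess s)%E.
Proof.
move=> h0; rewrite -integral_superlevel// /excess -ge0_integralD//=.
- apply: ge0_le_integral => //=.
  + by move=> x _; rewrite -EFinD lee_fin addr_ge0 ?pospart_ge0// mulr_ge0// ltW.
  + by apply: emeasurable_funD; [exact: measurable_superlevel_fun|exact/measurable_EFinP].
  + exact/measurable_EFinP.
  + by move=> x _; rewrite -EFinD lee_fin pospart_step_le.
- by move=> x _; rewrite lee_fin mulr_ge0// ltW.
- by move=> x _; rewrite lee_fin pospart_ge0.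
- exact/measurable_EFinP.
Qed.

Lemma excess_step_ge (h s : R) : 0 < h ->
  (excess s <= excess (s + h) + h%:E * nu [set x | (s < sigma x)%R])%E.
Proof.
move=> h0; rewrite -integral_superlevel// /excess -ge0_integralD//=.
- apply: ge0_le_integral => //=.
  + by move=> x _; rewrite lee_fin pospart_ge0.
  + exact/measurable_EFinP.
  + by apply: emeasurable_funD; [exact/measurable_EFinP|exact: measurable_superlevel_fun].
  + by move=> x _; rewrite -EFinD lee_fin pospart_step_ge.
- by move=> x _; rewrite lee_fin pospart_ge0.
- exact/measurable_EFinP.
- by move=> x _; rewrite lee_fin mulr_ge0// ltW.
Qed.

Context (K : T * T -> R) (HK : symmetric_markov_density nu K).
Context (N : nat) (lam : 'I_N -> R) (p : 'I_N -> T -> R).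
Context (p_measurable : forall j, measurable_fun setT (p j)).
Context (p_ge0 : forall j x, 0 <= p j x).
Context (p_sum : forall x, \sum_j p j x = 1).
Context (p_mass : forall j, (\int[nu]_x (p j x)%:E = N%:R^-1%:E)%E).
Context (p_lam : forall j, (\int[nu]_x (sigma x * p j x)%:E = (N%:R^-1 * lam j)%:E)%E).
Context (sigmaK_L1 : forall x, nu.-integrable setT (fun y => (sigma y * K (x, y))%:E)).
Context (sigmaK_lam : forall x,
  (\int[nu]_y (sigma y * K (x, y))%:E = (\sum_j lam j * p j x)%:E)%E).

Definition spectral_excess s : R := N%:R^-1 * \sum_j pospart s (lam j).

Let p_le1 j x : p j x <= 1.
Proof. by rewrite -(p_sum x) (bigD1 j)//= lerDl sumr_ge0. Qed.

Let p_L1 j : nu.-integrable setT (fun x => (p j x)%:E).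
Proof.
apply/integrableP; split; first exact/measurable_EFinP.
under eq_integral do rewrite gee0_abs ?lee_fin//.
by rewrite p_mass ltry.
Qed.

Let sigmap_L1 j : nu.-integrable setT (fun x => (sigma x * p j x)%:E).
Proof.
apply: le_integrable sigma_L1 => //.
  by apply/measurable_EFinP; exact: measurable_funM.
move=> x _; rewrite !abse_EFin lee_fin normrM ler_piMr// ger0_norm ?p_ge0//.
Qed.

(** Jensen for the probability measures [N p_j dnu]: the mean of [sigma] under the [j]-th one is
    [lam j]. Summing over [j] recovers the excess because the [p j] sum to 1. *)
Lemma spectral_excess_le s : ((spectral_excess s)%:E <= excess s)%E.
Proof.
have mp j : measurable_fun setT (fun x => (pospart s (sigma x) * p j x)%:E).
  by apply/measurable_EFinP; exact: measurable_funM.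
have pp0 j x : (0 <= (pospart s (sigma x) * p j x)%:E)%E.
  by rewrite lee_fin mulr_ge0 ?pospart_ge0.
have -> : excess s = (\sum_j \int[nu]_x (pospart s (sigma x) * p j x)%:E)%E.
  rewrite -ge0_integral_sum//=; apply: eq_integral => x _.
  by rewrite sumEFin -mulr_sumr p_sum mulr1.
rewrite /spectral_excess mulr_sumr -sumEFin; apply: lee_sum => j _.
(* With the factor inside the maximum, Jensen splits into two bounds: the integral dominates the
   affine term, and it is nonnegative. *)
have -> : N%:R^-1 * pospart s (lam j) = Num.max (N%:R^-1 * (lam j - s)) 0.
  by rewrite /pospart maxr_pMr ?invr_ge0// mulr0.
rewrite EFin_max ge_max.
rewrite integral_ge0 ?andbT//.
have -> : ((N%:R^-1 * (lam j - s))%:E =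
    \int[nu]_x ((sigma x * p j x)%:E - s%:E * (p j x)%:E))%E.
  rewrite integralB//=; last exact: integrableZl.
  by rewrite integralZl// p_lam p_mass -EFinM -EFinB mulrBr [s * _]mulrC.
apply: le_integral => //.
- by apply: integrableB => //; exact: integrableZl.
- apply: le_integrable (integrable_pospart s) => //.
  by move=> x _; rewrite !abse_EFin lee_fin normrM ler_piMr// ger0_norm ?p_ge0.
- by move=> x _; rewrite -EFinM -EFinB lee_fin -mulrBl ler_wpM2r ?pospart_ge.
Qed.

(** At each [x] the weights [p j x] average the eigenvalues to [B], the [K]-average of [sigma], and
    Jensen bounds [pospart s B]. Replacing [sigma x] by [B] costs [|sigma x - B|], as [pospart s] is
    1-Lipschitz, and the integral of this cost is at most the oscillation. *)
Lemma excess_le_spectral s :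
  (excess s <= (spectral_excess s)%:E + oscillation nu K sigma)%E.
Proof.
have mosc := measurable_osc HK sigma_measurable.
have osc_ge0 z : (0 <= (`|sigma z.2 - sigma z.1| * K z)%:E)%E.
  by rewrite lee_fin mulr_ge0// (smd_ge0 HK).
have mO := measurable_fun_fubini_tonelli_F (m2 := nu) _ mosc osc_ge0.
have mA : measurable_fun setT (fun x => (\sum_j pospart s (lam j) * p j x)%:E).
  by apply/measurable_EFinP; apply: measurable_sum => j; exact: measurable_funM.
have A0 x : (0 <= (\sum_j pospart s (lam j) * p j x)%:E)%E.
  by rewrite lee_fin sumr_ge0// => j _; rewrite mulr_ge0 ?pospart_ge0.
have O0 x : (0 <= fubini_F nu (fun z => (`|sigma z.2 - sigma z.1| * K z)%:E) x)%E.
  exact: integral_ge0.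
have -> : ((spectral_excess s)%:E =
    \int[nu]_x (\sum_j pospart s (lam j) * p j x)%:E)%E.
  under eq_integral do rewrite -sumEFin.
  rewrite ge0_integral_sum//=; first last.
  - by move=> j x _; rewrite lee_fin mulr_ge0 ?pospart_ge0.
  - by move=> j; apply/measurable_EFinP; exact: measurable_funM.
  rewrite /spectral_excess mulr_sumr -sumEFin; apply: eq_bigr => j _.
  under [RHS]eq_integral do rewrite EFinM.
  rewrite ge0_integralZl_EFin ?pospart_ge0 ?p_mass//; last exact/measurable_EFinP.
  - by rewrite -EFinM mulrC.
  - by move=> x _; rewrite lee_fin.
rewrite /oscillation fubini_tonelli1// -ge0_integralD//=.
apply: ge0_le_integral => //=.
- by move=> x _; rewrite lee_fin pospart_ge0.
- exact/measurable_EFinP.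
- exact: emeasurable_funD.
move=> x _; set B := \sum_j lam j * p j x.
have K_L1 : nu.-integrable setT (fun y => (K (x, y))%:E).
  apply/integrableP; split.
    by apply/measurable_EFinP; exact: measurable_density_slice HK _.
  under eq_integral do rewrite gee0_abs ?lee_fin ?(smd_ge0 HK)//.
  by rewrite (smd_mass HK) ltry.
(* Since [K (x, _)] has mass 1, [sigma x - B] is the [K]-average of [sigma x - sigma y]. *)
have oB : (`|(sigma x - B)%:E| <=
    fubini_F nu (fun z => (`|sigma z.2 - sigma z.1| * K z)%:E) x)%E.
  have -> : (sigma x - B)%:E =
      (- \int[nu]_y ((sigma y * K (x, y))%:E - (sigma x)%:E * (K (x, y))%:E))%E.
    rewrite integralB//=; last exact: integrableZl.
    by rewrite integralZl// (smd_mass HK) sigmaK_lam mule1 -EFinB -EFinN opprB.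
  rewrite abseN; apply: le_trans (le_abse_integral _ _ _) _ => //.
    apply: measurable_int; apply: integrableB => //; exact: integrableZl.
  rewrite le_eqVlt; apply/orP; left; apply/eqP/eq_integral => y _ /=.
  by rewrite -mulrBl normrM [`|K _|]ger0_norm ?(smd_ge0 HK).
apply: le_trans (leeD (lexx _) oB); rewrite abse_EFin -EFinD lee_fin.
apply: le_trans (pospart_lipschitz s _ B) _; rewrite lerD2r.
exact: pospart_sum.
Qed.

Definition spectral_fraction t : R := N%:R^-1 * \sum_j (t < lam j)%R%:R.
Local Notation c := spectral_fraction.

Let spectral_step_le h s : 0 < h ->
  h * c (s + h) + spectral_excess (s + h) <= spectral_excess s.
Proof.
move=> h0; rewrite /spectral_fraction /spectral_excess mulrCA -mulrDr ler_wpM2l ?invr_ge0//.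
rewrite mulr_sumr -big_split; apply: ler_sum => j _; exact: pospart_step_le.
Qed.

Let spectral_step_ge h s : 0 < h ->
  spectral_excess s <= spectral_excess (s + h) + h * c s.
Proof.
move=> h0; rewrite /spectral_fraction /spectral_excess mulrCA -mulrDr ler_wpM2l ?invr_ge0//.
rewrite mulr_sumr -big_split; apply: ler_sum => j _; exact: pospart_step_ge.
Qed.

(** With [D] the oscillation, [h * nu {sigma > t + h}] is at most [excess t - excess (t + h)], hence
    at most [spectral_excess t - spectral_excess (t + h) + D] by the two Jensen bounds, hence at
    most [h * c t + D]. *)
Lemma superlevel_le_spectral_count (t h : R) : 0 < h ->
  (nu [set x | (t + h < sigma x)%R] <=
   (c t)%:E + h^-1%:E * oscillation nu K sigma)%E.
Proof.
move=> h0; have := excess_le_spectral t; have := oscillation_ge0 HK sigma.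
have /fineK <- : nu [set x | (t + h < sigma x)%R] \is a fin_num.
  exact/fin_num_measure/measurable_superlevel_sigma.
have := excess_step_le t h0.
have /fineK <- : nu [set x | (t + h < sigma x)%R] \is a fin_num.
  exact/fin_num_measure/measurable_superlevel_sigma.
have := spectral_excess_le (t + h).
rewrite -(fineK (excess_fin_num t)) -(fineK (excess_fin_num (t + h))).
have := spectral_step_ge t h0.
(* An infinite oscillation makes the bound trivial. *)
case: oscillation => [D| |] //; last first.
  by move=> *; rewrite gt0_muley ?lte_fin ?invr_gt0// addey ?leey.
rewrite -!(EFinM, EFinD) !lee_fin => sE Es eE _ eo.
by rewrite -lerBlDl ler_pdivlMl// mulrBr; lra.
Qed.

(** The same chain on [[t - h, t]] with the roles exchanged: the step bound from below is used for
    the eigenvalues and the one from above for [sigma]. *)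
Lemma spectral_count_le_superlevel (t h : R) : 0 < h ->
  ((c t)%:E <= nu [set x | (t - h < sigma x)%R] + h^-1%:E * oscillation nu K sigma)%E.
Proof.
move=> h0; have := excess_le_spectral t; have := oscillation_ge0 HK sigma.
have := excess_step_ge (t - h) h0.
have /fineK <- : nu [set x | (t - h < sigma x)%R] \is a fin_num.
  exact/fin_num_measure/measurable_superlevel_sigma.
have := spectral_excess_le (t - h).
rewrite subrK -(fineK (excess_fin_num t)) -(fineK (excess_fin_num (t - h))).
have := spectral_step_le (t - h) h0; rewrite subrK.
case: oscillation => [D| |] //; last first.
  by move=> *; rewrite gt0_muley ?lte_fin ?invr_gt0// addey ?leey.
rewrite -!(EFinM, EFinD) !lee_fin => sE Es eE _ eo.
by rewrite -lerBlDl ler_pdivlMl// mulrBr; lra.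
Qed.

End spectral_counting.

(** * Orthonormal eigenbases *)

Section orthonormal_eigenbasis.
Context (R : realType) (H : vectType R[i]) (ip : {dot H for conjC}).

Lemma ipC u v : ip u v = conjc (ip v u).
Proof. by rewrite (hermC ip u v) expr0 mul1r. Qed.

Lemma ipZl a u v : ip (a *: u) v = a * ip u v.
Proof. by rewrite linearZl_LR. Qed.

Lemma ipZr a u v : ip u (a *: v) = conjc a * ip u v.
Proof. by rewrite linearZr_LR. Qed.

Lemma ipDl u v w : ip (u + v) w = ip u w + ip v w.
Proof. by rewrite linearDl. Qed.

Lemma ipBl u v w : ip (u - v) w = ip u w - ip v w.
Proof. by rewrite linearBl. Qed.

Lemma ip_suml (I : Type) (s : seq I) (c : I -> R[i]) (f : I -> H) v :
  ip (\sum_(i <- s) c i *: f i) v = \sum_(i <- s) c i * ip (f i) v.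
Proof.
elim: s => [|i s IH]; first by rewrite !big_nil linear0l.
by rewrite !big_cons ipDl ipZl IH.
Qed.

Lemma ip_eq0C u v : ip u v = 0 -> ip v u = 0.
Proof. by move=> uv; rewrite ipC uv conjc0. Qed.

(** Gram-Schmidt by induction on the dimension: normalize one vector of [U] and continue in its
    orthogonal complement inside [U]. Subspaces are allowed because the eigenspaces need bases
    too. *)
Lemma orthonormal_basis_exists (U : {vspace H}) :
  exists s, [/\ orthonormal ip s, size s = \dim U & {subset s <= U}].
Proof.
have [n] := ubnP (\dim U); elim: n U => // n IHn U.
have [->|U0] := eqVneq U 0%VS; first by exists [::]; rewrite dimv0.
rewrite ltnS => Un.
have v0 : vpick U != 0 by rewrite vpick0.
pose e := (sqrtC (ip (vpick U) (vpick U)))^-1 *: vpick U.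
have e1 : ip e e = 1.
  have p0 : ip (vpick U) (vpick U) != 0 by rewrite dnorm_eq0.
  rewrite dnormZ normfV ger0_norm ?sqrt_dnorm_ge0// exprVn sqrtCK mulVf//.
have eU : e \in U by rewrite memvZ ?memv_pick.
have eNU : e \notin orthov ip U.
  by apply/mem_orthovPn; exists e => //; rewrite -[X in X != 0]/(ip e e) e1 oner_eq0.
have dU := eq_dim_orthov1 eNU.
have [|s [os ss sU]] := IHn (U :&: orthov ip <[e]>)%VS.
  by rewrite -dU; move: U0; rewrite -dimv_eq0; case: (\dim U) Un.
exists (e :: s); split.
- rewrite -cat1s orthonormal_cat os /= andbT; apply/andP; split.
    by rewrite /orthonormal /= e1 eqxx.
  apply/allP => v /sU; rewrite memv_cap mem_orthov1.
  by move=> /andP[_ /eqP ve]; apply/eqP; exact: ip_eq0C.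
- by rewrite /= ss -dU prednK// lt0n dimv_eq0.
- by move=> v; rewrite inE => /predU1P[->//|/sU]; rewrite memv_cap => /andP[].
Qed.

(** Orthonormal bases of the eigenspaces are concatenated over the distinct entries of [l]. Each
    entry occurs in [l] as often as the dimension of its eigenspace, so the result has as many
    vectors as [l] has entries. Pairs keep every vector next to its eigenvalue. *)
Lemma orthonormal_eigenbasis (T : 'End(H)) (l : (\dim {:H}).-tuple R) :
  (forall f g, ip (T f) g = ip f (T g)) -> eigenvalue_list T l ->
  exists s : seq (R * H),
    [/\ perm_eq (unzip1 s) l, orthonormal ip (unzip2 s) &
        {in s, forall zu, T zu.2 = zu.1%:C *: zu.2}].
Proof.
move=> Tsym [_ lT].
have /choice[B HB] (z : R) :=
  orthonormal_basis_exists (passmx.leigenspace T z%:C).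
have eigB z v : v \in B z -> T v = z%:C *: v.
  have [_ _ /[apply]] := HB z; rewrite memv_ker !lfunE/= !lfunE/= scale_lfunE id_lfunE.
  by rewrite subr_eq0 => /eqP.
have cB z : size (B z) = count_mem z l.
  have [_ -> _] := HB z; rewrite -lT count_map; apply: eq_count => r /=.
  by rewrite (inj_eq (@complexI R)).
exists (flatten [seq [seq (z, u) | u <- B z] | z <- undup l]); split.
- apply: perm_trans (perm_count_undup l).
  rewrite /unzip1 map_flatten -map_comp.
  rewrite (eq_map (g := fun z => nseq (count_mem z l) z)) // => z /=.
  by rewrite -map_comp -cB; elim: (B z) => //= _ s ->.
- rewrite /unzip2 map_flatten -map_comp.
  rewrite (eq_map (g := B)); last first.
    by move=> z /=; rewrite -map_comp map_id_in.
  elim: (undup l) (undup_uniq l) => //= z zs IH /andP[zzs uzs].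
  rewrite orthonormal_cat IH//=; apply/andP; split; first by have [] := HB z.
  apply/orthogonalP => v w vz /flatten_mapP[y yzs wy].
  (* Moving [T] across the form evaluates [ip (T v) w] in two ways; distinct real eigenvalues then
     force [ip v w = 0]. *)
  have : z%:C * ip v w = y%:C * ip v w.
    by rewrite -ipZl -eigB// Tsym (eigB y)// ipZr conjc_real.
  move/eqP; rewrite -subr_eq0 -mulrBl mulf_eq0 => /orP[|/eqP//].
  rewrite subr_eq0 => /eqP/complexI zy.
  by rewrite zy yzs in zzs.
- move=> _ /flatten_mapP[z _ /mapP[u uB ->]] /=; exact: eigB.
Qed.

End orthonormal_eigenbasis.

(** * Complex-valued integrals *)

Lemma ReM (R : rcfType) (a b : R[i]) :
  complex.Re (a * b) = complex.Re a * complex.Re b - complex.Im a * complex.Im b.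
Proof. by case: a b => [a1 a2] [b1 b2]. Qed.

Lemma ImM (R : rcfType) (a b : R[i]) :
  complex.Im (a * b) = complex.Re a * complex.Im b + complex.Im a * complex.Re b.
Proof. by case: a b => [a1 a2] [b1 b2]. Qed.

Lemma Re_sum (R : rcfType) (I : Type) (s : seq I) (f : I -> R[i]) :
  complex.Re (\sum_(i <- s) f i) = \sum_(i <- s) complex.Re (f i).
Proof. by apply: big_morph => // -[a b] [c e]. Qed.

Lemma Im_sum (R : rcfType) (I : Type) (s : seq I) (f : I -> R[i]) :
  complex.Im (\sum_(i <- s) f i) = \sum_(i <- s) complex.Im (f i).
Proof. by apply: big_morph => // -[a b] [c e]. Qed.

Lemma sqr_normcE (R : rcfType) (z : R[i]) :
  Normc.normc z ^+ 2 = complex.Re z ^+ 2 + complex.Im z ^+ 2.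
Proof. by case: z => a b /=; rewrite sqr_sqrtr// addr_ge0 ?sqr_ge0. Qed.

Lemma mulc_conj (R : rcfType) (z : R[i]) : z * conjc z = (Normc.normc z ^+ 2)%:C.
Proof.
rewrite sqr_normcE; case: z => a b /=; apply/eqP; rewrite eq_complex /=.
by apply/andP; split; apply/eqP; ring.
Qed.

Lemma normc_conj (R : rcfType) (z : R[i]) : Normc.normc (conjc z) = Normc.normc z.
Proof. by case: z => a b /=; rewrite sqrrN. Qed.

Section complex_integral.
Context d (T : measurableType d) (R : realType) (mu : {measure set T -> \bar R}).
Implicit Types (f g : T -> R[i]) (a : R[i]).

(** The shape [a * f + g] serves both the linearity of the operator and the induction over finite
    sums. *)
Lemma CintegrableZD a f g : Cintegrable mu f -> Cintegrable mu g ->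
  Cintegrable mu (fun x => a * f x + g x).
Proof.
move=> [f1 f2] [g1 g2]; split.
- rewrite (_ : (fun x => _) = (fun x => ((complex.Re a)%:E * (complex.Re (f x))%:E -
      (complex.Im a)%:E * (complex.Im (f x))%:E) + (complex.Re (g x))%:E)%E).
    by apply: integrableD => //; apply: integrableB => //; exact: integrableZl.
  by apply/funext => x; rewrite -!EFinM -EFinB -EFinD raddfD/= ReM.
- rewrite (_ : (fun x => _) = (fun x => ((complex.Re a)%:E * (complex.Im (f x))%:E +
      (complex.Im a)%:E * (complex.Re (f x))%:E) + (complex.Im (g x))%:E)%E).
    by apply: integrableD => //; apply: integrableD => //; exact: integrableZl.
  by apply/funext => x; rewrite -!EFinM -!EFinD raddfD/= ImM.
Qed.

Lemma CintegralZD a f g : Cintegrable mu f -> Cintegrable mu g ->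
  Cintegral mu (fun x => a * f x + g x) = a * Cintegral mu f + Cintegral mu g.
Proof.
move=> [f1 f2] [g1 g2]; have Z r (h : T -> R) : mu.-integrable setT (EFin \o h) ->
    mu.-integrable setT (EFin \o (fun x => r * h x)).
  move=> ih; rewrite (_ : _ \o _ = fun x => r%:E * (h x)%:E)%E//.
  exact: integrableZl.
have D (h h' : T -> R) : mu.-integrable setT (EFin \o h) ->
    mu.-integrable setT (EFin \o h') ->
    mu.-integrable setT (EFin \o (fun x => h x + h' x)).
  by move=> ih ih'; have := integrableD measurableT ih ih'.
have B (h h' : T -> R) : mu.-integrable setT (EFin \o h) ->
    mu.-integrable setT (EFin \o h') ->
    mu.-integrable setT (EFin \o (fun x => h x - h' x)).
  by move=> ih ih'; have := integrableB measurableT ih ih'.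
apply/eqP; rewrite eq_complex !raddfD /= ReM ImM /=.
under eq_Rintegral do rewrite raddfD/= ReM.
under [X in _ && (X == _)]eq_Rintegral do rewrite raddfD/= ImM.
apply/andP; split; apply/eqP.
- rewrite RintegralD//.
    by rewrite RintegralB ?RintegralZl//; exact: Z.
  by apply: B; exact: Z.
- rewrite RintegralD//.
    by rewrite RintegralD ?RintegralZl//; exact: Z.
  by apply: D; exact: Z.
Qed.

Lemma Cintegral0 : Cintegrable mu (fun=> 0) /\ Cintegral mu (fun=> 0) = 0.
Proof.
split; first by split; exact: integrable0.
by rewrite /Cintegral/= /Rintegral !integral0.
Qed.

Lemma Cintegral_sum (I : Type) (s : seq I) (c : I -> R[i]) (f : I -> T -> R[i]) :
  (forall i, Cintegrable mu (f i)) ->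
  Cintegrable mu (fun x => \sum_(i <- s) c i * f i x) /\
  Cintegral mu (fun x => \sum_(i <- s) c i * f i x) =
    \sum_(i <- s) c i * Cintegral mu (f i).
Proof.
move=> fi; elim: s => [|i s [IH1 IH2]].
  by rewrite big_nil; under eq_fun do rewrite big_nil; exact: Cintegral0.
rewrite big_cons; under eq_fun do rewrite big_cons.
by rewrite CintegralZD// IH2; split => //; exact: CintegrableZD.
Qed.

Lemma Cintegral_conj f : Cintegrable mu f ->
  Cintegral mu (fun x => conjc (f x)) = conjc (Cintegral mu f).
Proof.
move=> [_ f2]; rewrite /Cintegral /=.
have E z : complex.Re (conjc z) = complex.Re z :> R by case: z.
have E' z : complex.Im (conjc z) = -1 * complex.Im z :> R by case: z => a b /=; rewrite mulN1r.
under eq_Rintegral do rewrite E.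
under [X in _ +i* X]eq_Rintegral do rewrite E'.
by rewrite RintegralZl// mulN1r.
Qed.

Lemma Cintegral_real (f : T -> R[i]) (h : T -> R) :
  (forall x, f x = (h x)%:C) -> Cintegrable mu f ->
  mu.-integrable setT (EFin \o h) /\
  (\int[mu]_x (h x)%:E = (complex.Re (Cintegral mu f))%:E)%E.
Proof.
move=> /funext -> [f1 _]; split=> //.
by rewrite /Cintegral/= /Rintegral fineK//; exact: integrable_fin_num f1.
Qed.

End complex_integral.

(** * Toeplitz operators *)

Section orthonormal_expansion.
Context (R : realType) (H : vectType R[i]) (ip : {dot H for conjC}).
Context (s : seq H) (s_on : orthonormal ip s) (s_size : size s = \dim {:H}).

(** An orthonormal family is free, so by its size [s] spans [H]. The remainder is orthogonal to [s],
    hence to itself, hence zero. *)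
Lemma orthonormal_expansion f : f = \sum_(u <- s) ip f u *: u.
Proof.
have [us ips] := elimT orthonormalP s_on.
have fs := orthonormal_free s_on.
have sp : span s = fullv.
  apply/eqP; rewrite eqEdim subvf /= -s_size; move: fs.
  by rewrite /free => /eqP ->.
apply/eqP; rewrite -subr_eq0 -(dnorm_eq0 ip).
set g := f - _.
have og : orthogonal ip [:: g] s.
  apply/orthoPl => v vs; rewrite /g ipBl ip_suml /=.
  rewrite (bigD1_seq v)//= (ips v v)// eqxx mulr1 big1_seq ?addr0 ?subrr//.
  by move=> u /andP[uv us']; rewrite (ips u v)// (negbTE uv) mulr0.
by apply/eqP; apply: (span_orthogonal og); rewrite ?memv_span1 ?sp ?memvf.
Qed.

Lemma orthonormal_ipE f g : ip f g = \sum_(u <- s) ip f u * conjc (ip g u).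
Proof.
rewrite {1}(orthonormal_expansion f) ip_suml; apply: eq_bigr => u _.
by rewrite [ip u g]ipC.
Qed.

Lemma orthonormal_parseval f :
  complex.Re (ip f f) = \sum_(u <- s) Normc.normc (ip f u) ^+ 2.
Proof.
rewrite orthonormal_ipE Re_sum; apply: eq_bigr => u _.
by rewrite mulc_conj.
Qed.

End orthonormal_expansion.

Lemma ip_inj (R : realType) (H : vectType R[i]) (ip : {dot H for conjC}) (u v : H) :
  (forall g, ip u g = ip v g) -> u = v.
Proof.
move=> uv; apply/eqP; rewrite -subr_eq0 -(dnorm_eq0 ip).
by rewrite ipBl uv subrr.
Qed.

Lemma integrableM_bounded d (T : measurableType d) (R : realType)
    (mu : {measure set T -> \bar R}) (f w : T -> R) (M : R) :
  mu.-integrable setT (EFin \o f) -> measurable_fun setT w ->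
  (forall x, `|w x| <= M) ->
  mu.-integrable setT (fun x => (f x * w x)%:E).
Proof.
move=> fi mw wM.
have M0 (x : T) : 0 <= M by have := wM x; apply: le_trans.
have mf : measurable_fun setT f by apply/measurable_EFinP; exact: measurable_int fi.
apply: (le_integrable measurableT _ _ (integrableZl measurableT M fi)).
  by apply/measurable_EFinP; exact: measurable_funM.
move=> x _; rewrite /= lee_fin !normrM mulrC ler_wpM2r//.
by rewrite (ger0_norm (M0 x)).
Qed.

Section toeplitz_operator.
Context (R : realType) (H : vectType R[i]) (ip : {dot H for conjC}).
Context d (T : measurableType d) (mu : {measure set T -> \bar R}).
Context (k : T -> H) (k_norm : forall x, ip (k x) (k x) = 1).
Context (k_measurable : forall f, Cmeasurable (fun x => ip f (k x))).

(** Cauchy-Schwarz with the unit vector [k x]. Frame coefficients are therefore bounded, and their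
    products with an unbounded L^1 symbol stay integrable. *)
Lemma sqr_normc_ip_le f x :
  Normc.normc (ip f (k x)) ^+ 2 <= complex.Re (ip f f).
Proof.
have [+ _] := CauchySchwarz ip f (k x).
rewrite k_norm mulr1 sqr_normcE -add_Re2_Im2.
by rewrite lecE => /andP[].
Qed.

Lemma measurable_sqr_normc_ip f :
  measurable_fun setT (fun x => Normc.normc (ip f (k x)) ^+ 2).
Proof.
have [m1 m2] := k_measurable f.
under eq_fun do rewrite sqr_normcE.
by apply: measurable_funD; apply: measurable_funX.
Qed.

Context (sigma : T -> R) (sigma_L1 : mu.-integrable setT (EFin \o sigma)).

Let F f g x := (sigma x)%:C * (ip f (k x) * conjc (ip g (k x))).

Let toeplitz_integrandE f g x :
  ip (((sigma x)%:C * ip f (k x)) *: k x) g = F f g x.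
Proof. by rewrite ipZl [ip (k x) g]ipC -mulrA. Qed.

Let F_integrable f g : Cintegrable mu (F f g).
Proof.
have [f1 f2] := k_measurable f; have [g1 g2] := k_measurable g.
have M0 h : 0 <= complex.Re (ip h h).
  by have := dnorm_ge0 ip h; rewrite lecE => /andP[].
(* From [a ^+ 2 + b ^+ 2 <= M] the crude bound [M + 1] on [|a|] and [|b|] follows without square
   roots. *)
have bound h x : (`|complex.Re (ip h (k x))| <= complex.Re (ip h h) + 1) /\
    (`|complex.Im (ip h (k x))| <= complex.Re (ip h h) + 1).
  have := sqr_normc_ip_le h x; have := M0 h; rewrite sqr_normcE.
  move: (complex.Re (ip h h)) (complex.Re (ip h (k x))) (complex.Im (ip h (k x))).
  by move=> M a b M1 abM; split; rewrite ler_norml; apply/andP; split; nra.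
have E z w : complex.Re (z * conjc w) =
    complex.Re z * complex.Re w + complex.Im z * complex.Im w :> R.
  by case: z w => [a b] [c e] /=; ring.
have E' z w : complex.Im (z * conjc w) =
    complex.Im z * complex.Re w - complex.Re z * complex.Im w :> R.
  by case: z w => [a b] [c e] /=; ring.
pose B := (complex.Re (ip f f) + 1) * (complex.Re (ip g g) + 1).
have bnd x (a b : R) : `|a| <= complex.Re (ip f f) + 1 ->
    `|b| <= complex.Re (ip g g) + 1 -> `|a * b| <= B.
  by move=> ? ?; rewrite normrM ler_pM.
split.
- under eq_fun do rewrite /F ReM /= mul0r subr0 E.
  apply: (integrableM_bounded (M := B + B) sigma_L1).
    by apply: measurable_funD; exact: measurable_funM.
  move=> x; have [a1 a2] := bound f x; have [b1 b2] := bound g x.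
  by apply: le_trans (ler_normD _ _) _; apply: lerD; exact: bnd.
- under eq_fun do rewrite /F ImM /= mul0r addr0 E'.
  apply: (integrableM_bounded (M := B + B) sigma_L1).
    by apply: measurable_funB; exact: measurable_funM.
  move=> x; have [a1 a2] := bound f x; have [b1 b2] := bound g x.
  by apply: le_trans (ler_normB _ _) _; apply: lerD; exact: bnd.
Qed.

Let L f := weak_integral ip mu (fun x => ((sigma x)%:C * ip f (k x)) *: k x).

(** A weak integral has to be exhibited, since [weak_integral] otherwise returns its default
    value. *)
Let weak_integral_toeplitz f g : ip (L f) g = Cintegral mu (F f g).
Proof.
suff [h hE] : exists h, is_weak_integral ip mu
    (fun x => ((sigma x)%:C * ip f (k x)) *: k x) h.
  have [_ ->] := @xgetPex _ 0 _ (ex_intro _ h hE) g.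
  by congr Cintegral; apply/funext => x; exact: toeplitz_integrandE.
have [s [s_on s_size _]] := orthonormal_basis_exists ip {:H}.
(* Testing against the basis vectors prescribes the coordinates of the witness; expanding [v] in the
   basis extends the identity to every test vector. *)
exists (\sum_(u <- s) Cintegral mu (F f u) *: u) => v.
have -> : (fun x => ip (((sigma x)%:C * ip f (k x)) *: k x) v) =
    (fun x => \sum_(u <- s) ip u v * F f u x).
  apply/funext => x; rewrite toeplitz_integrandE /F.
  rewrite {1}(orthonormal_expansion s_on s_size v) ip_suml /= rmorph_sum/=.
  rewrite !mulr_sumr; apply: eq_bigr => u _.
  by rewrite rmorphM [ip u v]ipC /=; ring.
have [fi ->] := Cintegral_sum s (fun u => ip u v) (fun u => F_integrable f u).
split => //; rewrite ip_suml; apply: eq_bigr => u _.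
by rewrite mulrC.
Qed.

(** [toeplitz] is built with [linfun], which can be evaluated as the given map once that map is
    known to be linear. *)
Let L_linear : linear L.
Proof.
move=> a f f'; apply: (@ip_inj _ _ ip) => g.
rewrite ipDl ipZl !weak_integral_toeplitz -CintegralZD//.
congr Cintegral; apply/funext => x; rewrite /F ipDl ipZl /=; ring.
Qed.

Lemma toeplitzE f g : ip (toeplitz ip mu k sigma f) g = 
  Cintegral mu (fun x => (sigma x)%:C * (ip f (k x) * conjc (ip g (k x)))).
Proof.
pose Lm : {linear H -> H} := HB.pack L (GRing.isLinear.Build _ _ _ _ L L_linear).
by rewrite /toeplitz (lfunE Lm) weak_integral_toeplitz.
Qed.

(** Because [sigma] is real, conjugating the integrand exchanges [f] and [g]. *)
Lemma toeplitz_sym f g :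
  ip (toeplitz ip mu k sigma f) g = ip f (toeplitz ip mu k sigma g).
Proof.
rewrite [RHS]ipC !toeplitzE -(Cintegral_conj (F_integrable g f)).
congr Cintegral; apply/funext => x.
rewrite /F; case: (ip f (k x)) (ip g (k x)) => [a b] [c e]; apply/eqP.
by rewrite eq_complex /=; apply/andP; split; apply/eqP; ring.
Qed.

Lemma toeplitz_diag f :
  mu.-integrable setT (fun x => (sigma x * Normc.normc (ip f (k x)) ^+ 2)%:E) /\
  (\int[mu]_x (sigma x * Normc.normc (ip f (k x)) ^+ 2)%:E =
   (complex.Re (ip (toeplitz ip mu k sigma f) f))%:E)%E.
Proof.
rewrite toeplitzE; apply: Cintegral_real => [x|]; last exact: (F_integrable f f).
by rewrite mulc_conj -rmorphM.
Qed.

End toeplitz_operator.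

(** * Parseval frames *)

Section scaled_measure.
Context d (T : measurableType d) (R : realType).
Context (mu nu : {measure set T -> \bar R}) (c : R) (c_gt0 : 0 < c).
Context (mu_nu : forall B, measurable B -> mu B = (c%:E * nu B)%E).

Lemma ge0_integral_scaled D (f : T -> \bar R) : measurable D ->
  measurable_fun D f -> (forall x, D x -> 0 <= f x)%E ->
  (\int[mu]_(x in D) f x = c%:E * \int[nu]_(x in D) f x)%E.
Proof.
move=> mD mf f0; pose r := NngNum (ltW c_gt0).
rewrite (@eq_measure_integral _ _ _ _ (mscale r nu)).
  by rewrite (ge0_integral_mscale nu mD r mf f0).
by move=> B mB _; rewrite mu_nu.
Qed.

Lemma integrable_scaled D (f : T -> \bar R) : measurable D ->
  nu.-integrable D f -> mu.-integrable D f.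
Proof.
move=> mD /integrableP[mf fi]; apply/integrableP; split => //.
rewrite ge0_integral_scaled//; last exact: measurableT_comp.
by rewrite lte_mul_pinfty// lee_fin ltW.
Qed.

Lemma integral_scaled D (f : T -> \bar R) : measurable D ->
  nu.-integrable D f ->
  (\int[nu]_(x in D) f x = c^-1%:E * \int[mu]_(x in D) f x)%E.
Proof.
move=> mD fi; have mf : measurable_fun D f by exact: measurable_int fi.
rewrite integralE [in RHS]integralE.
have pf : (\int[nu]_(x in D) f^\+ x)%E \is a fin_num.
  exact: integrable_pos_fin_num.
have nf : (\int[nu]_(x in D) f^\- x)%E \is a fin_num.
  exact: integrable_neg_fin_num.
rewrite !ge0_integral_scaled//; [|exact: measurable_funeneg|exact: measurable_funepos].
rewrite -muleBr//; last exact: fin_num_adde_defr.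
by rewrite muleA -EFinM mulVf ?mul1e// gt_eqF.
Qed.

End scaled_measure.

(** * Spectral estimate for a single Parseval frame *)

Section frame_spectral_estimate.
Context (R : realType) (X : ptopologicalType).
Context (H : vectType R[i]) (ip : {dot H for conjC}) (k : X -> H).
Context (mu : {measure set (Borel X) -> \bar R}) (frame : parseval_frame ip mu k).
Context (nu : {finite_measure set (Borel X) -> \bar R}).
Context (mu_nu : forall B : set (Borel X), measurable B ->
  mu B = ((\dim {:H})%:R%:E * nu B)%E).

Definition frame_density (z : Borel X * Borel X) : R :=
  (\dim {:H})%:R * Normc.normc (ip (k z.1) (k z.2)) ^+ 2.

Let k_norm x : ip (k x) (k x) = 1.
Proof.
by have := frame_normalized frame x; rewrite /hnorm => e; rewrite -[LHS]sqrtCK e expr1n.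
Qed.

Let k_measurable f : @Cmeasurable _ (Borel X) R (fun x => ip f (k x)).
Proof. exact: (frame_measurable frame). Qed.

(** The space [X] is pointed, so [H] contains the unit vector [k point]. *)
Lemma frame_dim_gt0 : 0 < (\dim {:H})%:R :> R.
Proof.
rewrite ltr0n lt0n; apply/eqP => H0.
have k0 : k point = 0.
  apply/eqP; rewrite -memv0.
  have /eqP <- : fullv == 0%VS :> {vspace H} by rewrite -dimv_eq0 H0.
  exact: memvf.
by have := k_norm point; rewrite k0 linear0l => /eqP; rewrite eq_sym oner_eq0.
Qed.

(** The reproducing formula for [f] is tested against [f] itself. *)
Lemma frame_parseval f :
  (\int[mu]_x (Normc.normc (ip f (k x)) ^+ 2)%:E = (complex.Re (ip f f))%:E)%E.
Proof.
have [fi ->] := frame_reproducing frame f f.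
have [//|_ ->//] := @Cintegral_real _ (Borel X) R mu _
  (fun x => Normc.normc (ip f (k x)) ^+ 2) _ fi.
by move=> x; rewrite ipZl [ip (k x) f]ipC mulc_conj.
Qed.

(** The hypotheses give measurability in one variable at a time. Expanding [ip (k x) (k y)] in a
    finite orthonormal basis writes it as a finite sum of products of one-variable functions, which
    is measurable for the product of the two Borel sigma-algebras. *)
Lemma measurable_frame_density : measurable_fun setT frame_density.
Proof.
have [s [s_on s_size _]] := orthonormal_basis_exists ip {:H}.
apply: measurable_funM => //.
have mfst f : measurable_fun setT (fun z : Borel X * Borel X => complex.Re (ip f (k z.1))) /\
   measurable_fun setT (fun z : Borel X * Borel X => complex.Im (ip f (k z.1))).
  have [m1 m2] := k_measurable f.
  by split; [apply: (measurableT_comp m1)|apply: (measurableT_comp m2)].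
have msnd f : measurable_fun setT (fun z : Borel X * Borel X => complex.Re (ip f (k z.2))) /\
   measurable_fun setT (fun z : Borel X * Borel X => complex.Im (ip f (k z.2))).
  have [m1 m2] := k_measurable f.
  by split; [apply: (measurableT_comp m1)|apply: (measurableT_comp m2)].
have E z : ip (k z.1) (k z.2) = \sum_(u <- s) conjc (ip u (k z.1)) * ip u (k z.2).
  rewrite (orthonormal_ipE s_on s_size); apply: eq_bigr => u _.
  by rewrite [ip (k z.1) u]ipC [ip (k z.2) u]ipC conjcK.
under eq_fun do rewrite sqr_normcE E Re_sum Im_sum.
have Re2 a b : complex.Re (conjc a * b) =
    complex.Re a * complex.Re b + complex.Im a * complex.Im b :> R.
  by case: a b => [a1 a2] [b1 b2] /=; ring.
have Im2 a b : complex.Im (conjc a * b) =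
    complex.Re a * complex.Im b - complex.Im a * complex.Re b :> R.
  by case: a b => [a1 a2] [b1 b2] /=; ring.
apply: measurable_funD; apply: measurable_funX; apply: measurable_sum => u.
- under eq_fun do rewrite Re2.
  have [? ?] := mfst u; have [? ?] := msnd u.
  by apply: measurable_funD; exact: measurable_funM.
- under eq_fun do rewrite Im2.
  have [? ?] := mfst u; have [? ?] := msnd u.
  by apply: measurable_funB; exact: measurable_funM.
Qed.

Let msq f : measurable_fun setT (fun x : Borel X => Normc.normc (ip f (k x)) ^+ 2).
Proof. exact: measurable_sqr_normc_ip. Qed.

Lemma integral_frame_density x (D : set (Borel X)) : measurable D ->
  (\int[nu]_(y in D) (frame_density (x, y))%:E =
   \int[mu]_(y in D) (Normc.normc (ip (k x) (k y)) ^+ 2)%:E)%E.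
Proof.
move=> mD.
have mf : measurable_fun D (fun y : Borel X =>
    (Normc.normc (ip (k x) (k y)) ^+ 2)%:E).
  by apply/measurable_EFinP; exact: measurable_funTS.
rewrite (ge0_integral_scaled frame_dim_gt0 mu_nu)//; last first.
  by move=> y _; rewrite lee_fin sqr_ge0.
rewrite -ge0_integralZl_EFin// ?ltW ?frame_dim_gt0//.
by move=> y _; rewrite lee_fin sqr_ge0.
Qed.

(** Symmetry is that of the Hermitian form, and mass 1 is the frame Parseval identity at the unit
    vector [k x]; the dimension factor turns [nu] into [mu]. *)
Lemma frame_density_markov : symmetric_markov_density nu frame_density.
Proof.
split.
- exact: measurable_frame_density.
- by move=> z; rewrite /frame_density mulr_ge0 ?sqr_ge0.
- by move=> x y; rewrite /frame_density /= ipC normc_conj.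
- by move=> x; rewrite integral_frame_density// frame_parseval k_norm.
Qed.

Context (sigma : Borel X -> R) (sigma_L1 : nu.-integrable setT (EFin \o sigma)).
Context (l : (\dim {:H}).-tuple R).
Context (l_eigen : eigenvalue_list (toeplitz ip mu k sigma) l).

Let mu_sigma : mu.-integrable setT (EFin \o sigma).
Proof. exact: (integrable_scaled frame_dim_gt0 mu_nu). Qed.

Let T := toeplitz ip mu k sigma.
Let fraction t : R := (\dim {:H})%:R^-1 * (count (fun r => t < r) l)%:R.

Lemma frame_spectral_estimate t h : 0 < h ->
  (nu [set x | (t + h < sigma x)%R] <=
     (fraction t)%:E + h^-1%:E * oscillation nu frame_density sigma)%E /\
  ((fraction t)%:E <=
     nu [set x | (t - h < sigma x)%R] + h^-1%:E * oscillation nu frame_density sigma)%E.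
Proof.
have Tsym f g : ip (T f) g = ip f (T g) by exact: toeplitz_sym.
have [s [sl s_on sT]] := orthonormal_eigenbasis Tsym l_eigen.
have s_size : size s = \dim {:H} by rewrite -(size_map fst) (perm_size sl) size_tuple.
pose lam (j : 'I_(size s)) := (nth (0, 0) s j).1.
pose u (j : 'I_(size s)) := (nth (0, 0) s j).2.
pose p j (x : Borel X) : R := Normc.normc (ip (u j) (k x)) ^+ 2.
have sumE (V : nmodType) (G : R * H -> V) :
    \sum_(j < size s) G (nth (0, 0) s j) = \sum_(zu <- s) G zu.
  by rewrite (big_nth (0, 0)) big_mkord.
have u_size : size (unzip2 s) = \dim {:H} by rewrite size_map.
have Tu j : T (u j) = (lam j)%:C *: u j by apply: sT; rewrite mem_nth.
have uu j : ip (u j) (u j) = 1.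
  have [_ ->] := elimT orthonormalP s_on; rewrite ?eqxx//;
  by apply/map_f; rewrite mem_nth.
have invN : (size s)%:R^-1 = (\dim {:H})%:R^-1 :> R by rewrite s_size.
have fractionE t' : fraction t' = spectral_fraction lam t'.
  rewrite /fraction /spectral_fraction invN; congr (_ * _).
  rewrite (sumE _ (fun zu => (t' < zu.1)%R%:R)) -natr_sum; congr (_%:R).
  by rewrite -(permP sl) count_map -sum1_count big_mkcond.
(* Parseval for the eigenbasis at the unit vector [k x]; the next identity is Parseval for the frame
   at the unit vector [u j]. *)
have p_sum x : \sum_j p j x = 1.
  rewrite (sumE _ (fun zu => Normc.normc (ip zu.2 (k x)) ^+ 2)).
  transitivity (complex.Re (ip (k x) (k x))); last by rewrite k_norm.
  rewrite (orthonormal_parseval s_on u_size) big_map.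
  by apply: eq_bigr => zu _; rewrite ipC normc_conj.
have p_mass j : (\int[nu]_x (p j x)%:E = (size s)%:R^-1%:E)%E.
  have := frame_parseval (u j); rewrite uu.
  rewrite (ge0_integral_scaled frame_dim_gt0 mu_nu)//; last 2 first.
  - exact/measurable_EFinP.
  - by move=> x _; rewrite lee_fin sqr_ge0.
  move=> e; rewrite invN -[RHS]mule1 -e muleA -EFinM mulVf ?mul1e//.
  by rewrite gt_eqF ?frame_dim_gt0.
have p_bound f x : `|Normc.normc (ip f (k x)) ^+ 2| <= complex.Re (ip f f).
  by rewrite ger0_norm ?sqr_ge0//; exact: (@sqr_normc_ip_le R H ip _ (Borel X) k k_norm).
have sp_L1 f : nu.-integrable setT
    (fun x => (sigma x * Normc.normc (ip f (k x)) ^+ 2)%:E).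
  exact: (integrableM_bounded sigma_L1 (msq f) (p_bound f)).
have sp f : (\int[nu]_x (sigma x * Normc.normc (ip f (k x)) ^+ 2)%:E =
    ((\dim {:H})%:R^-1 * complex.Re (ip (T f) f))%:E)%E.
  rewrite (integral_scaled frame_dim_gt0 mu_nu)//.
  by have [_ ->] := @toeplitz_diag R H ip _ (Borel X) mu k k_norm
    k_measurable sigma mu_sigma f.
have p_lam j : (\int[nu]_x (sigma x * p j x)%:E = ((size s)%:R^-1 * lam j)%:E)%E.
  by rewrite sp Tu ipZl uu mulr1 invN.
have sKE x : (fun y => (sigma y * frame_density (x, y))%:E) =
    (fun y => (\dim {:H})%:R%:E * (sigma y * Normc.normc (ip (k x) (k y)) ^+ 2)%:E)%E.
  by apply/funext => y; rewrite /frame_density -EFinM mulrCA.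
have sK_L1 x : nu.-integrable setT (fun y => (sigma y * frame_density (x, y))%:E).
  by rewrite sKE; exact: integrableZl.
(* Both sides are the Berezin transform [ip (T (k x)) (k x)]: the left one through the integral
   defining [T], the right one through the expansion of [k x] in the eigenbasis. *)
have sK_lam x : (\int[nu]_y (sigma y * frame_density (x, y))%:E =
    (\sum_j lam j * p j x)%:E)%E.
  rewrite sKE integralZl// sp -EFinM mulrA divff ?gt_eqF ?frame_dim_gt0// mul1r.
  congr EFin.
  rewrite {1}(orthonormal_expansion s_on u_size (k x)) big_map linear_sum.
  rewrite (eq_big_seq (fun zu => (ip (k x) zu.2 * zu.1%:C) *: zu.2)); last first.
    by move=> zu zus; rewrite linearZ /= sT// scalerA.
  rewrite ip_suml Re_sum (sumE _ (fun zu => zu.1 * Normc.normc (ip zu.2 (k x)) ^+ 2)).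
  apply: eq_bigr => zu _; rewrite [ip (k x) _]ipC.
  have -> (z : R[i]) (r : R) : conjc z * r%:C * z = r%:C * (z * conjc z) by ring.
  by rewrite mulc_conj -rmorphM.
have p_measurable j : measurable_fun setT (p j) by exact: msq.
have p_ge0 j x : 0 <= p j x by exact: sqr_ge0.
move=> h0; rewrite fractionE; split.
  exact: (superlevel_le_spectral_count sigma_L1 frame_density_markov p_measurable
            p_ge0 p_sum p_mass p_lam sK_L1 sK_lam).
exact: (spectral_count_le_superlevel sigma_L1 frame_density_markov p_measurable
          p_ge0 p_sum p_mass p_lam sK_L1 sK_lam).
Qed.

End frame_spectral_estimate.

(** * The limit *)

Section superlevel_continuity.
Context d (T : measurableType d) (R : realType).
Context (nu : {finite_measure set T -> \bar R}) (sigma : T -> R).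
Context (sigma_measurable : measurable_fun setT sigma).

Let msup (t : R) : measurable [set x | t < sigma x].
Proof. exact: measurable_superlevel. Qed.

(** Continuity from below along an increasing union of superlevel sets. *)
Lemma superlevel_cvg_right (t : R) :
  nu [set x | t + n.+1%:R^-1 < sigma x] @[n --> \oo] --> nu [set x | t < sigma x].
Proof.
have E : [set x | t < sigma x] = \bigcup_n [set x | t + n.+1%:R^-1 < sigma x].
  apply/seteqP; split => [x /= tx|x [n _] /=]; last first.
    by apply: lt_trans; rewrite ltrDl invr_gt0.
  have x0 : 0 < sigma x - t by rewrite subr_gt0.
  have [n _ /(_ n (leqnn n)) nx] := near_infty_natSinv_lt (PosNum x0).
  by exists n => //=; rewrite -ltrBrDl.
rewrite [X in _ --> nu X]E; apply: (@nondecreasing_cvg_mu _ _ _ nu).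
- by move=> n; exact: msup.
- by rewrite -E.
- move=> m n mn; apply/subsetPset => x /=; apply: le_lt_trans.
  by rewrite lerD2l lef_pV2 ?posrE// ler_nat.
Qed.

(** Continuity from above gives the measure of [sigma >= t] as the limit; the null level set at [t]
    is what allows passing to the strict inequality. *)
Lemma superlevel_cvg_left (t : R) : nu [set x | sigma x = t] = 0%E ->
  nu [set x | t - n.+1%:R^-1 < sigma x] @[n --> \oo] --> nu [set x | t < sigma x].
Proof.
move=> t0.
have mt : measurable [set x | sigma x = t].
  by rewrite -[X in measurable X]setTI; exact: sigma_measurable (measurable_set1 t).
have E : [set x | sigma x = t] `|` [set x | t < sigma x] =
    \bigcap_n [set x | t - n.+1%:R^-1 < sigma x].
  apply/seteqP; split => [x /= tx n _ /=|x /= xt].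
    have : t <= sigma x by case: tx => [->|/ltW].
    by apply: lt_le_trans; rewrite ltrBlDr ltrDl invr_gt0.
  case: (ltgtP t (sigma x)) => [|xt'|->]; [by right| |by left].
  have x0 : 0 < t - sigma x by rewrite subr_gt0.
  have [n _ /(_ n (leqnn n)) /= nx] := near_infty_natSinv_lt (PosNum x0).
  by have := xt n I; rewrite /= ltrBlDr -ltrBlDl => /(lt_trans nx); rewrite ltxx.
have nuE : nu ([set x | sigma x = t] `|` [set x | t < sigma x]) =
  nu [set x | t < sigma x] by rewrite setUC measureU0.
rewrite -[X in _ --> X]nuE E; apply: (@nonincreasing_cvg_mu _ _ _ nu).
- by rewrite ltey_eq fin_num_measure.
- by move=> n; exact: msup.
- by rewrite -E; exact: measurableU.
- move=> m n mn; apply/subsetPset => x /=; apply: le_lt_trans.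
  by rewrite lerD2l lerN2 lef_pV2 ?posrE// ler_nat.
Qed.

End superlevel_continuity.

(** * Eigenvalue asymptotics along a sequence *)

Section spectral_limit.
Context (R : realType) (X : ptopologicalType) (X_hausdorff : hausdorff_space X).
Context (H : nat -> vectType R[i]) (ip : forall n, {dot (H n) for conjC}).
Context (k : forall n, X -> H n).
Context (mu : nat -> {measure set (Borel X) -> \bar R}).
Context (frame : forall n, parseval_frame (ip n) (mu n) (k n)).
Context (nu : {finite_measure set (Borel X) -> \bar R}) (nu_radon : radon nu).
Context (mu_nu : forall n (B : set (Borel X)), measurable B ->
  mu n B = ((\dim {:H n})%:R%:E * nu B)%E).
Context (localized : forall (x : X) (U : set (Borel X)), nbhs x U -> measurable U ->
  (\int[mu n]_(y in ~` U) ((Normc.normc (ip n (k n x) (k n y))) ^+ 2)%:E)%E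
    @[n --> \oo] --> 0%E).
Context (sigma : Borel X -> R).
Context (sigma_L1 : nu.-integrable [set: Borel X] (fun x => (sigma x)%:E)).
Context (l : forall n, (\dim {:H n}).-tuple R).
Context (l_eigen : forall n,
  eigenvalue_list (toeplitz (ip n) (mu n) (k n) sigma) (l n)).

(** The order of choices matters: the step [h] is fixed first by continuity of the superlevel
    measures, and only then is [n] taken large enough for the oscillation to be small compared with
    [h]. *)
Lemma spectral_limit (t : R) : nu [set x | sigma x = t] = 0%E ->
  (((\dim {:H n})%:R)^-1 * (count (fun r => t < r) (l n))%:R)%:E
    @[n --> \oo] --> nu [set x | t < sigma x].
Proof.
move=> t0; pose c n : R := (\dim {:H n})%:R^-1 * (count (fun r => t < r) (l n))%:R.
have mS : measurable_fun setT sigma by apply/measurable_EFinP; exact: measurable_int sigma_L1.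
have osc0 : oscillation nu (frame_density (ip n) (k n)) sigma @[n --> \oo] --> 0%E.
  apply: (oscillation_cvg0 X_hausdorff nu_radon) => //.
    by move=> n; exact: frame_density_markov (frame n) _ (@mu_nu n).
  move=> U x oU Ux.
  have mU : measurable (U : set (Borel X)) by exact: sub_sigma_algebra.
  under eq_fun do rewrite (integral_frame_density (frame _) (@mu_nu _) x (measurableC mU)).
  by apply: localized => //; exact: open_nbhs_nbhs.
set S := nu _.
have Sfin : S \is a fin_num.
  by apply: fin_num_measure; exact: measurable_superlevel.
rewrite -(fineK Sfin); apply/fine_cvgP; split; first exact: nearW.
apply/cvgrPdist_le => e e0; have e20 : 0 < e / 2 by rewrite divr_gt0.
have := @superlevel_cvg_right _ _ _ nu _ mS t.
rewrite -/S -{1}(fineK Sfin) => /fine_cvgP[rfin /cvgrPdist_le/(_ _ e20) rS].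
have := @superlevel_cvg_left _ _ _ nu _ mS _ t0.
rewrite -/S -{1}(fineK Sfin) => /fine_cvgP[lfin /cvgrPdist_le/(_ _ e20) lS].
(* One index [m] brings both shifted superlevel measures within half of [e] of [S]; the step is then
   the inverse of [m.+1]. *)
have [m [[rm lm] [rSm lSm]]] : exists m,
   (nu [set x | t + m.+1%:R^-1 < sigma x] \is a fin_num /\
    nu [set x | t - m.+1%:R^-1 < sigma x] \is a fin_num) /\
   (`|fine S - fine (nu [set x | t + m.+1%:R^-1 < sigma x])| <= e / 2 /\
    `|fine S - fine (nu [set x | t - m.+1%:R^-1 < sigma x])| <= e / 2).
  have [m _ /(_ m (leqnn m))] := filterI (filterI rfin lfin) (filterI rS lS).
  by move=> [[? ?] [? ?]]; exists m.
have h0 : 0 < m.+1%:R^-1 :> R by rewrite invr_gt0.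
(* After division by the step, this threshold for the oscillation leaves the other half of [e]. *)
have eh0 : 0 < e / 2 * m.+1%:R^-1 by rewrite mulr_gt0.
have osc_ge0 n : (0 <= oscillation nu (frame_density (ip n) (k n)) sigma)%E.
  exact: oscillation_ge0 (frame_density_markov (frame n) (@mu_nu n)) _.
move/ge0_cvge0P : osc0 => /(_ osc_ge0 _ eh0); apply: filterS => n osc_n /=.
have osc_n' : ((m.+1%:R^-1)^-1%:E * oscillation nu (frame_density (ip n) (k n)) sigma
    <= (e / 2)%:E)%E.
  by rewrite lee_pdivrMl// -EFinM mulrC.
have [] := frame_spectral_estimate (frame n) (@mu_nu n) sigma_L1 (l_eigen n) t h0.
move=> /le_trans/(_ (leeD2l _ osc_n')) + /le_trans/(_ (leeD2l _ osc_n')).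
rewrite -(fineK rm) -(fineK lm) -!EFinD !lee_fin -/(c n) => A B.
move: rSm lSm; rewrite !ler_norml => /andP[C1 C2] /andP[D1 D2].
by apply/andP; split; lra.
Qed.

End spectral_limit.

(** * From sequences to a real parameter *)

(** Dominated convergence was applied along sequences, so the real parameter is reduced to them. If
    the limit failed for a neighborhood [V], each [n] would admit a point of [A] beyond [n] with
    value outside [V], and these points form a sequence contradicting the hypothesis. *)
Lemma within_pinfty_cvgP (R : realType) (A : set R) (f : R -> \bar R) (l : \bar R) :
  (forall u : nat -> R, (forall n, A (u n)) ->
    u n @[n --> \oo] --> within A (pinfty_nbhs R) -> f (u n) @[n --> \oo] --> l) ->
  f a @[a --> within A (pinfty_nbhs R)] --> l.
Proof.
move=> fu; apply: contrapT => /existsNP[V] /not_implyP[lV nV].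
have /choice[u Hu] (n : nat) : exists a, [/\ n%:R < a, A a & ~ V (f a)].
  apply: contrapT => na; apply: nV; exists n%:R; split; first exact: num_real.
  move=> a na' Aa; apply: contrapT => nVa; apply: na; by exists a.
have uA n : A (u n) by have [] := Hu n.
have uoo : u n @[n --> \oo] --> within A (pinfty_nbhs R).
  move=> B [M [_ MB]].
  have [N _ NM] := nbhs_infty_gtr M.
  exists N => // n /NM /= Mn.
  have [nu_ _ _] := Hu n; apply: MB => //; exact: lt_trans nu_.
have [N _ /(_ N (leqnn N))] := fu u uA uoo V lV.
by have [] := Hu N.
Qed.

Theorem corollary4p5 (R : realType) (X : ptopologicalType)
  (X_compact : compact [set: X]) (X_hausdorff : hausdorff_space X)
  (A : set R)
  (H : R -> vectType R[i]) (ip : forall a : R, {dot (H a) for conjC})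
  (k : forall a : R, X -> H a)
  (nu_ : R -> {measure set (Borel X) -> \bar R})
  (frame : forall a, A a -> parseval_frame (ip a) (nu_ a) (k a))
  (nu : {finite_measure set (Borel X) -> \bar R}) (nu_radon : radon nu)
  (nu_E : forall a, A a -> forall B : set (Borel X), measurable B ->
    nu_ a B = ((\dim {:H a})%:R%:E * nu B)%E)
  (localized : forall (x : X) (U : set (Borel X)), nbhs x U -> measurable U ->
    (\int[nu_ a]_(y in ~` U) ((Normc.normc (ip a (k a x) (k a y))) ^+ 2)%:E)%E
      @[a --> within A (pinfty_nbhs R)] --> 0%E)
  (sigma : Borel X -> R)
  (sigma_L1 : nu.-integrable [set: Borel X] (fun x => (sigma x)%:E))
  (sigma_bounded_or_ge0 :
    (exists M : R, {ae nu, forall x, `|sigma x| <= M}) \/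
    {ae nu, forall x, 0 <= sigma x})
  (lambda : forall a : R, (\dim {:H a}).-tuple R)
  (lambda_eigenvalues : forall a, A a ->
    eigenvalue_list (toeplitz (ip a) (nu_ a) (k a) sigma) (lambda a))
  (t : R) (t_null : nu [set x | sigma x = t] = 0%E) :
  (((\dim {:H a})%:R)^-1 * (count (fun r => t < r) (lambda a))%:R)%:E
    @[a --> within A (pinfty_nbhs R)] --> nu [set x | t < sigma x].
Proof.
(* Along a sequence in [A] the hypotheses on the frames, measures and eigenvalues hold at every
   index, and localization is composed with the sequence. *)
apply: within_pinfty_cvgP => u uA uoo.
apply: (spectral_limit X_hausdorff (fun n => frame _ (uA n)) nu_radon
  (fun n => nu_E _ (uA n)) _ sigma_L1 (fun n => lambda_eigenvalues _ (uA n)) t_null).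
by move=> x U xU mU; exact: (cvg_comp u _ uoo (localized x U xU mU)).
Qed.
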